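(* Let $n$ and $k$ be positive integers. For $\lambda,\mu\in\mathcal{P}_{k,n}$, the endomorphism $T^{\lambda}_{\mu}$ of $V^{\boxtimes k}$ depends only on the equivalence class $\mathcal{C}$ of $(\lambda,\mu)$ with respect to $\sim$; write $T^{\mathcal{C}}=T^{\lambda}_{\mu}$ for any $(\lambda,\mu)\in\mathcal{C}$. Then the family $\{T^{\mathcal{C}}\}_{\mathcal{C}}$, indexed by the equivalence classes $\mathcal{C}$ with respect to $\sim$ on the set $\mathcal{P}_{k,n}\times\mathcal{P}_{k,n}$, is a basis of $\mathrm{End}_{S_n}\left(V^{\boxtimes k}\right)$.
   Context: Vector spaces are over $\mathbb{C}$. $V$ is an $n$-dimensional vector space with a fixed basis $\mathbf{v}_1,\ldots,\mathbf{v}_n$. $\boxtimes$ denotes the freest commutative bilinear operation, and $V^{\boxtimes k}$ is the $k$-fold $\boxtimes$-power of $V$: the quotient of $V^{\otimes k}$ by the subspace spanned by all differences $\mathbf{w}_1\otimes\cdots\otimes\mathbf{w}_k-\mathbf{w}_{\tau(1)}\otimes\cdots\otimes\mathbf{w}_{\tau(k)}$ with $\mathbf{w}_i\in V$ and $\tau\in S_k$, the class of $\mathbf{w}_1\otimes\cdots\otimes\mathbf{w}_k$ being written $\mathbf{w}_1\boxtimes\cdots\boxtimes\mathbf{w}_k$. An integer partition is a finite weakly decreasing tuple $\lambda=(\lambda_1,\ldots,\lambda_{\ell(\lambda)})$ of positive integers, of length $\ell(\lambda)$. Let $\mathcal{P}_{k,n}$ be the set of integer partitions $\lambda$ with $\ell(\lambda)=k$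 and $\ell(\lambda^{\mathrm{T}})\le n$, where $\lambda^{\mathrm{T}}$ is the transpose; that is, partitions with exactly $k$ parts, all at most $n$. For $\lambda\in\mathcal{P}_{k,n}$ put $\mathbf{v}_\lambda=\mathbf{v}_{\lambda_1}\boxtimes\cdots\boxtimes\mathbf{v}_{\lambda_k}$; the family $\{\mathbf{v}_\lambda\}_{\lambda\in\mathcal{P}_{k,n}}$ is a basis of $V^{\boxtimes k}$. The symmetric group $S_n$ acts linearly on $V^{\boxtimes k}$ by $\sigma(\mathbf{v}_{i_1}\boxtimes\cdots\boxtimes\mathbf{v}_{i_k})=\mathbf{v}_{\sigma(i_1)}\boxtimes\cdots\boxtimes\mathbf{v}_{\sigma(i_k)}$, and $\mathrm{End}_{S_n}(V^{\boxtimes k})$ is the algebra of linear endomorphisms of $V^{\boxtimes k}$ commuting with this action. For $\sigma\in S_n$ and $\lambda\in\mathcal{P}_{k,n}$, $\sigma\lambda=\mathrm{sort}(\sigma(\lambda_1),\ldots,\sigma(\lambda_k))$ is the partition obtained by sorting the entries $\sigma(\lambda_1),\ldots,\sigma(\lambda_k)$. For $\lambda,\mu\in\mathcal{P}_{k,n}$, $E^{\lambda}_{\mu}\in\mathrm{End}(V^{\boxtimes k})$ is the linear map sending $\mathbf{v}_\lambda$ to $\mathbf{v}_\mu$ and $\mathbf{v}_\nu$ to $0$ for every $\nu\in\mathcal{P}_{k,n}$, $\nu\ne\lambda$. Define $T^{\lambda}_{\mu}=\sum E^{\nu}_{\gamma}$, the sum being over all ordered pairs $(\nu,\gamma)\in\mathcal{P}_{k,n}\times\mathcal{P}_{k,n}$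 for which there exists $\rho\in S_n$ with $\lambda=\rho\nu$ and $\mu=\rho\gamma$. The equivalence relation $\sim$ on $\mathcal{P}_{k,n}\times\mathcal{P}_{k,n}$ is: $(a,b)\sim(c,d)$ if and only if there exists $\sigma\in S_n$ with $a=\sigma c$ and $b=\sigma d$. *)

(* Defs.v *)
(* All constructions are carried out over an arbitrary field F; they are meant
   to be used with F := R[i], the complex numbers, for R : realType. *)
From HB Require Import structures.
From mathcomp Require Import all_boot all_order all_algebra all_fingroup.
From mathcomp Require Import generic_quotient ring_quotient.
From mathcomp Require Import boolp classical_sets reals.
From mathcomp Require Import complex.

Set Implicit Arguments.
Unset Strict Implicit.
Unset Printing Implicit Defensive.

Import GRing.Theory.
Local Open Scope ring_scope.

Section QuotientSpace.
Variables (F : fieldType) (T : vectType F) (U : {vspace T}).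

Definition vquot : Type := Quotient.quot (pred_of_vspace U).
HB.instance Definition _ := GRing.Zmodule.on vquot.

Definition vpi (x : T) : vquot := (\pi_(Quotient.quot (pred_of_vspace U)) x)%qT.
Definition vrepr (q : vquot) : T := repr (q : Quotient.quot (pred_of_vspace U)).

Lemma vreprK : cancel vrepr vpi.
Proof. by move=> q; rewrite /vpi /vrepr reprK. Qed.

Lemma vpi_eq x y : (vpi x == vpi y) = (x - y \in U).
Proof. by rewrite /vpi -Quotient.idealrBE. Qed.

Lemma vpiB : {morph vpi : x y / x - y}.
Proof. by move=> x y; rewrite /vpi !piE. Qed.

Lemma vpiD : {morph vpi : x y / x + y}.
Proof. by move=> x y; rewrite /vpi !piE. Qed.

Definition vquot_scale (a : F) (q : vquot) : vquot := vpi (a *: vrepr q).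

Lemma vpiZ_subproof a x : vquot_scale a (vpi x) = vpi (a *: x).
Proof.
by apply/eqP; rewrite vpi_eq -scalerBr rpredZ // -vpi_eq vreprK.
Qed.

Lemma vquot_scaleA a b q :
  vquot_scale a (vquot_scale b q) = vquot_scale (a * b) q.
Proof. by rewrite -[q]vreprK !vpiZ_subproof scalerA. Qed.
Lemma vquot_scale1 : left_id 1 vquot_scale.
Proof. by move=> q; rewrite -[q]vreprK vpiZ_subproof scale1r. Qed.
Lemma vquot_scaleDr : right_distributive vquot_scale +%R.
Proof.
move=> a p q; rewrite -[p]vreprK -[q]vreprK -vpiD !vpiZ_subproof.
by rewrite scalerDr vpiD.
Qed.
Lemma vquot_scaleDl q : {morph vquot_scale^~ q : a b / a + b}.
Proof.
by move=> a b; rewrite -[q]vreprK !vpiZ_subproof scalerDl vpiD.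
Qed.

HB.instance Definition _ := GRing.Zmodule_isLmodule.Build F vquot
  vquot_scaleA vquot_scale1 vquot_scaleDr vquot_scaleDl.

Lemma vpi_is_linear : linear vpi.
Proof. by move=> a x y; rewrite vpiD -vpiZ_subproof. Qed.
HB.instance Definition _ := GRing.isSemilinear.Build F T vquot _ vpi
  (GRing.semilinear_linear vpi_is_linear).

Fact vquot_vect_iso : Vector.axiom (\dim U^C) vquot.
Proof.
have cap0' : (U :&: U^C = 0)%VS by rewrite capv_compl.
have cap0 : (U^C :&: U = 0)%VS by rewrite capvC.
have full w : (w \in U^C + U)%VS by rewrite addvC addv_complf memvf.
pose p := daddv_pi U^C U.
have pB x y : x - y \in U -> p x = p y.
  move=> xyU; apply/eqP; rewrite -subr_eq0 -linearB /=.
  have := daddv_pi_add cap0 (full (x - y)).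
  by rewrite (daddv_pi_id cap0' xyU) => /(canRL (addrK _)); rewrite subrr => ->.
have pr x : p (vrepr (vpi x)) = p x by apply: pB; rewrite -vpi_eq vreprK.
exists (fun q => \row_i coord (vbasis U^C) i (p (vrepr q))).
  move=> a x y; rewrite -[x]vreprK -[y]vreprK -linearP /= !pr linearP.
  by apply/rowP => i; rewrite !mxE linearP.
exists (fun r : 'rV_(\dim U^C) => vpi (\sum_i r 0 i *: (vbasis U^C)`_i)) => [q|r].
  under eq_bigr do rewrite mxE.
  rewrite -coord_vbasis ?memv_pi //; apply/eqP.
  rewrite -{2}[q]vreprK vpi_eq -memvN opprB.
  rewrite -{1}(daddv_pi_add cap0 (full (vrepr q))) addrAC subrr add0r.
  exact: memv_pi.
apply/rowP => i; rewrite mxE pr (daddv_pi_id cap0).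
  by rewrite coord_sum_free ?(basis_free (vbasisP _)).
by apply: rpred_sum => j _; rewrite rpredZ ?vbasis_mem ?memt_nth.
Qed.

HB.instance Definition _ := Lmodule_hasFinDim.Build F vquot vquot_vect_iso.

End QuotientSpace.

Section SpanOfSet.
Variables (F : fieldType) (T : vectType F).

Lemma span_set_exists (A : set T) : exists U : {vspace T},
  (forall x, A x -> x \in U) /\
  (forall Y : {vspace T}, (forall x, A x -> x \in Y) -> (U <= Y)%VS).
Proof.
pose P d := `[< exists2 s : seq T, (forall x, x \in s -> A x) & \dim <<s>>%VS = d >].
have exP : exists d, P d by exists (\dim <<[::] : seq T>>%VS); apply/asboolP; exists [::].
have ubP d : P d -> (d <= \dim {:T})%N.
  by move=> /asboolP [s _ <-]; exact: dimvS (subvf _).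
case: (ex_maxnP exP ubP) => d /asboolP [s sA ds] dmax.
exists <<s>>%VS; split=> [x Ax|Y AY]; last by apply/span_subvP => x /sA /AY.
have le_d : (\dim <<x :: s>> <= \dim <<s>>)%N.
  rewrite ds; apply: dmax; apply/asboolP; exists (x :: s) => // y.
  by rewrite inE => /orP [/eqP->|/sA].
have sub : (<<s>> <= <<x :: s>>)%VS by rewrite span_cons addvSr.
have /eqP-> : <<s>>%VS == <<x :: s>>%VS by rewrite eqEdim sub.
by rewrite memv_span ?mem_head.
Qed.

(* The least subspace containing A, see mem_span_set and span_set_sub. *)
Definition span_set (A : set T) : {vspace T} := sval (cid (span_set_exists A)).

Lemma mem_span_set (A : set T) x : A x -> x \in span_set A.
Proof. exact: (svalP (cid (span_set_exists A))).1. Qed.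

Lemma span_set_sub (A : set T) (Y : {vspace T}) :
  (forall x, A x -> x \in Y) -> (span_set A <= Y)%VS.
Proof. exact: (svalP (cid (span_set_exists A))).2. Qed.

End SpanOfSet.

Section Multilinear.
Variables (F : fieldType) (V : vectType F) (k : nat).

Definition subst_slot (w : {ffun 'I_k -> V}) (i : 'I_k) (x : V) :
    {ffun 'I_k -> V} := [ffun j => if j == i then x else w j].

Definition multilinear (W : lmodType F) (phi : {ffun 'I_k -> V} -> W) : Prop :=
  forall w i, linear (fun x => phi (subst_slot w i x)).

Definition symmetric_map (W : Type) (phi : {ffun 'I_k -> V} -> W) : Prop :=
  forall (w : {ffun 'I_k -> V}) (tau : 'S_k), phi [ffun j => w (tau j)] = phi w.

Lemma subst_slot_id w i : subst_slot w i (w i) = w.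
Proof. by apply/ffunP => j; rewrite ffunE; case: eqP => [->|]. Qed.

Lemma multilinear_ext (W : lmodType F) m (b : m.-tuple V)
    (phi psi : {ffun 'I_k -> V} -> W) :
  basis_of fullv b -> multilinear phi -> multilinear psi ->
  (forall i : {ffun 'I_k -> 'I_m},
      phi [ffun j => tnth b (i j)] = psi [ffun j => tnth b (i j)]) ->
  forall w, phi w = psi w.
Proof.
move=> bb phiL psiL eqb.
suff H (s : seq 'I_k) (w : {ffun 'I_k -> V}) :
    (forall j, j \notin s -> exists a, w j = tnth b a) -> phi w = psi w.
  by move=> w; apply: (H (enum 'I_k)) => j; rewrite mem_enum.
elim: s w => [|j s IHs] w wb.
  have /fin_all_exists [f wf] j : exists a, w j = tnth b a by exact: wb.
  have -> : w = [ffun j => tnth b ([ffun j => f j] j)].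
    by apply/ffunP => j; rewrite !ffunE.
  exact: eqb.
rewrite -[w](subst_slot_id w j) (coord_basis bb (memvf (w j))).
pose lin (f : {ffun 'I_k -> V} -> W) (fL : multilinear f) : {linear V -> W} :=
  HB.pack (fun x => f (subst_slot w j x))
    (GRing.isLinear.Build F V W _ (fun x => f (subst_slot w j x)) (fL w j)).
rewrite -[LHS]/(lin phi phiL _) -[RHS]/(lin psi psiL _) !linear_sum.
apply: eq_bigr => a _; rewrite !linearZ /=; congr (_ *: _).
apply: IHs => l ls; rewrite ffunE; case: eqP => [_|/eqP lj].
  by exists a; rewrite (tnth_nth 0).
by apply: wb; rewrite inE negb_or lj.
Qed.

End Multilinear.

Section TensorPower.
Variables (F : fieldType) (V : vectType F) (k : nat).

(* The k-fold tensor power as k-dimensional arrays of coordinates in the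
   reference basis of V: w_1 (x) ... (x) w_k is the array of the products of the
   coordinates of the w_j. The universal property is tensor_universal. *)
Definition tensor_power : Type := {ffun {ffun 'I_k -> 'I_(\dim {:V})} -> F^o}.
HB.instance Definition _ := Vector.on tensor_power.

Definition tensor (w : {ffun 'I_k -> V}) : tensor_power :=
  [ffun i : {ffun 'I_k -> 'I_(\dim {:V})} =>
    \prod_(j < k) coord (vbasis {:V}) (i j) (w j)].

Lemma prod_subst_slot m (c : 'I_m -> {linear V -> F^o})
    (i : {ffun 'I_k -> 'I_m}) w j :
  linear (fun x => \prod_(l < k) c (i l) (subst_slot w j x l) : F^o).
Proof.
move=> a x y.
have E z : \prod_(l < k) c (i l) (subst_slot w j z l) =
    c (i j) z * \prod_(l < k | l != j) c (i l) (w l).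
  rewrite (bigD1 j) //= ffunE eqxx; congr (_ * _).
  by apply: eq_bigr => l /negbTE lj; rewrite ffunE lj.
by rewrite !E linearP mulrDl -mulrA.
Qed.

Lemma tensor_multilinear : multilinear tensor.
Proof.
move=> w j a x y; apply/ffunP => i; rewrite !ffunE.
exact: (prod_subst_slot (fun l => coord (vbasis {:V}) l)).
Qed.

Let b := vbasis {:V}.
Let e (i : {ffun 'I_k -> 'I_(\dim {:V})}) : {ffun 'I_k -> V} :=
  [ffun j => tnth b (i j)].

Lemma tensor_basis i i' : tensor (e i) i' = (i' == i)%:R.
Proof.
rewrite ffunE; have [->|/eqP/ffunP ne] := eqVneq i' i.
  rewrite big1 // => j _; rewrite ffunE (tnth_nth 0).
  by rewrite coord_free ?eqxx // (basis_free (vbasisP _)).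
have [j nej] : exists j, i' j <> i j.
  by apply: contrapT => /forallNP H; apply: ne => j; apply: contrapT (H j).
rewrite (bigD1 j) //= ffunE (tnth_nth 0) coord_free ?(basis_free (vbasisP _)) //.
by case: eqP => [/esym/nej|_]; rewrite ?mul0r.
Qed.

Lemma tensor_decomp (t : tensor_power) : t = \sum_i t i *: tensor (e i).
Proof.
apply/ffunP => i'; rewrite sum_ffunE (bigD1 i') //= big1 ?addr0 => [|i ne].
  by rewrite ffunE tensor_basis eqxx /GRing.scale /= mulr1.
by rewrite ffunE tensor_basis eq_sym (negbTE ne) /GRing.scale /= mulr0.
Qed.

Lemma tensor_universal (W : vectType F) (phi : {ffun 'I_k -> V} -> W) :
  multilinear phi ->
  exists! f : 'Hom(tensor_power, W), forall w, f (tensor w) = phi w.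
Proof.
move=> phiL.
pose g (t : tensor_power) : W := \sum_i t i *: phi (e i).
have gL : linear g.
  move=> a x y; rewrite /g scaler_sumr -big_split; apply: eq_bigr => i _.
  by rewrite !ffunE scalerDl scalerA.
pose gl : {linear tensor_power -> W} :=
  HB.pack g (GRing.isLinear.Build F tensor_power W _ g gL).
exists (linfun gl); split=> [w|f fphi].
  rewrite lfunE; move: w.
  apply: (@multilinear_ext _ _ _ _ _ b (gl \o tensor) _ (vbasisP _)) => //.
    by move=> w i a x y /=; rewrite tensor_multilinear gL.
  move=> i; rewrite /= /g (bigD1 i) //= big1 ?addr0 => [|i' ne].
    by rewrite tensor_basis eqxx scale1r.
  by rewrite tensor_basis (negbTE ne) scale0r.
apply/lfunP => t; rewrite lfunE [t in f t]tensor_decomp linear_sum /= /g.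
by apply: eq_bigr => i _; rewrite linearZ /= fphi.
Qed.

End TensorPower.

Section SymmetricPower.
Variables (F : fieldType) (V : vectType F) (k : nat).

Definition sym_relations : {vspace tensor_power V k} :=
  span_set [set t | exists (w : {ffun 'I_k -> V}) (tau : 'S_k),
                      t = tensor w - tensor [ffun j => w (tau j)]].

Definition sym_power : Type := vquot sym_relations.
HB.instance Definition _ := Vector.on sym_power.

Definition box (w : {ffun 'I_k -> V}) : sym_power := vpi sym_relations (tensor w).

Lemma box_multilinear : multilinear box.
Proof. by move=> w j a x y; rewrite /box tensor_multilinear linearP. Qed.

Lemma box_symmetric : symmetric_map box.
Proof.
move=> w tau; apply/esym/eqP; rewrite /box vpi_eq.
by apply: mem_span_set; exists w, tau.
Qed.

Lemma box_universal (W : vectType F) (phi : {ffun 'I_k -> V} -> W) :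
  multilinear phi -> symmetric_map phi ->
  exists! f : 'Hom(sym_power, W), forall w, f (box w) = phi w.
Proof.
move=> phiL phiS; have [f [fphi _]] := tensor_universal phiL.
have ker0 t : t \in sym_relations -> f t = 0.
  move=> tU; apply/eqP; rewrite -memv_ker; apply: subvP t tU.
  apply: span_set_sub => _ [w [tau ->]].
  by rewrite memv_ker linearB /= !fphi phiS subrr.
pose g (q : sym_power) : W := f (vrepr q).
have gpi t : g (vpi _ t) = f t.
  apply/eqP; rewrite -subr_eq0 -linearB /=; apply/eqP/ker0.
  by rewrite -vpi_eq vreprK.
have gL : linear g.
  move=> a x y; rewrite -[x]vreprK -[y]vreprK -linearP /= !gpi.
  by rewrite linearP.
pose gl : {linear sym_power -> W} :=
  HB.pack g (GRing.isLinear.Build F sym_power W _ g gL).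
exists (linfun gl); split=> [w|h hphi]; first by rewrite lfunE /= gpi fphi.
have hL : multilinear (fun w => h (box w)).
  by move=> w i a x y; rewrite box_multilinear linearP.
have [f' [_ f'U]] := tensor_universal hL.
have fE : f' = f by apply: f'U => w; rewrite fphi hphi.
pose hp : {linear tensor_power V k -> W} := h \o vpi sym_relations.
have hpE : f' = linfun hp by apply: f'U => w; rewrite lfunE.
apply/lfunP => q; rewrite lfunE /= /g -fE hpE lfunE /=.
by rewrite vreprK.
Qed.

End SymmetricPower.

Section Partitions.

Definition is_intpart (s : seq nat) : bool := sorted geq s && (0%N \notin s).

(* The (j+1)-st part of the transpose is the number of parts greater than j. *)
Definition transpose (s : seq nat) : seq nat :=
  [seq count (fun x => (j < x)%N) s | j <- iota 0 (\max_(x <- s) x)%N].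

Variables (k n : nat).

Definition ord_geq : rel 'I_n := fun i j => (j <= i)%N.

(* A partition with exactly k parts, all at most n, is stored as the weakly
   decreasing k-tuple of its parts minus one, so that the index set {1, ..., n}
   becomes 'I_n; the actual parts are given by parts, see parts_inj and partsP. *)
Definition kpart : predArgType := {l : k.-tuple 'I_n | sorted ord_geq l}.
HB.instance Definition _ := Finite.on kpart.
HB.instance Definition _ := SubType.on kpart.

Definition parts (lam : kpart) : seq nat := [seq (nat_of_ord i).+1 | i <- val lam].

Lemma parts_inj : injective parts.
Proof.
move=> l m /inj_map H; apply/val_inj/val_inj/H.
by move=> i j [/val_inj].
Qed.

Lemma partsP (s : seq nat) :
  (exists lam, parts lam = s) <->
  [/\ is_intpart s, size s = k & (size (transpose s) <= n)%N].
Proof.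
rewrite size_map size_iota; split=> [[lam <-]|[/andP[s_sorted s_pos] sk sn]].
  rewrite size_map size_tuple; split=> //; last first.
    by rewrite big_map; apply/bigmax_leqP_seq => i _ _.
  rewrite /is_intpart sorted_map (valP lam : sorted ord_geq _).
  by apply/mapP => -[].
have sle x : x \in s -> (x <= n)%N.
  by move=> xs; apply: leq_trans sn; exact: (@leq_bigmax_seq _ s xpredT (fun y : nat => y) x xs isT).
have spos x : x \in s -> (0 < x)%N.
  by rewrite lt0n => xs; apply: contraNneq s_pos => <-.
have ex : exists l : seq 'I_n, [seq (nat_of_ord i).+1 | i <- l] = s.
  elim: s sle spos {s_sorted s_pos sk sn} => [|x s IHs] sle spos; first by exists [::].
  have [y|y|l <-] := IHs; rewrite ?inE; first by move=> ys; apply: sle; rewrite inE ys orbT.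
    by move=> ys; apply: spos; rewrite inE ys orbT.
  have xn : (x.-1 < n)%N by rewrite prednK ?spos ?sle ?mem_head.
  by exists (Ordinal xn :: l); rewrite /= prednK ?spos ?mem_head.
case: ex => l ls.
have lk : size l == k by rewrite -sk -ls size_map.
have l_sorted : sorted ord_geq (Tuple lk) by move: s_sorted; rewrite -ls sorted_map.
by exists (exist _ (Tuple lk) l_sorted).
Qed.

Lemma ord_geq_total : total ord_geq.
Proof. by move=> i j; exact: leq_total. Qed.
Lemma ord_geq_trans : transitive ord_geq.
Proof. by move=> i j l ji il; exact: leq_trans il ji. Qed.
Lemma ord_geq_anti : antisymmetric ord_geq.
Proof. by move=> i j /andP[ji ij]; apply/val_inj/eqP; rewrite eqn_leq; apply/andP; split. Qed.

Definition sortp (t : k.-tuple 'I_n) : kpart :=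
  exist (fun l : k.-tuple 'I_n => sorted ord_geq l) [tuple of sort ord_geq t]
    (sort_sorted ord_geq_total t).

Definition pact (sigma : 'S_n) (lam : kpart) : kpart :=
  sortp [tuple of [seq sigma i | i <- val lam]].

Lemma sortpP (s t : k.-tuple 'I_n) : reflect (sortp s = sortp t) (perm_eq s t).
Proof.
apply: (iffP idP) => [st|/(congr1 (fun l => tval (val l))) /= H].
  apply/val_inj/val_inj/perm_sortP => //.
  - exact: ord_geq_total.
  - exact: ord_geq_trans.
  - exact: ord_geq_anti.
apply: (@perm_trans _ (sort ord_geq s)); first by rewrite perm_sym perm_sort.
by rewrite H perm_sort.
Qed.

Lemma sortp_id (lam : kpart) : sortp (val lam) = lam.
Proof. by apply/val_inj/val_inj/sorted_sort/(valP lam); exact: ord_geq_trans. Qed.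

Lemma pact1 lam : pact 1 lam = lam.
Proof.
rewrite -[RHS]sortp_id; apply/sortpP.
by rewrite /= (eq_map (fun i => perm1 i)) map_id.
Qed.

Lemma pactM (s t : 'S_n) lam : pact (s * t) lam = pact t (pact s lam).
Proof.
apply/sortpP; rewrite /= (eq_map (fun i => permM s t i)) map_comp.
by apply: perm_map; rewrite perm_sym perm_sort.
Qed.

Definition sim (p q : kpart * kpart) : bool :=
  [exists sigma : 'S_n, (p.1 == pact sigma q.1) && (p.2 == pact sigma q.2)].

Lemma sim_equivalence : equivalence_rel sim.
Proof.
apply/equivalence_relP; split=> [p|p q /existsP[s /andP[/eqP e1 /eqP e2]] r].
  by apply/existsP; exists 1%g; rewrite !pact1 !eqxx.
apply/existsP/existsP => -[t /andP[/eqP f1 /eqP f2]].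
  exists (t * s^-1)%g; rewrite !pactM -f1 -f2 e1 e2 -!pactM.
  by rewrite mulgV !pact1 !eqxx.
by exists (t * s)%g; rewrite !pactM -f1 -f2 e1 e2 !eqxx.
Qed.

Definition sim_classes : {set {set kpart * kpart}} :=
  equivalence_partition sim [set: kpart * kpart].

End Partitions.

Section SymmetricAlgebra.
Variables (F : fieldType) (V : vectType F) (n : nat) (v : n.-tuple V) (k : nat).

Definition boxv (i : 'I_k -> 'I_n) : sym_power V k := box [ffun j => tnth v (i j)].

Definition vpart (lam : kpart k n) : sym_power V k := boxv (tnth (val lam)).

Definition vpart_tuple : #|kpart k n|.-tuple (sym_power V k) :=
  [tuple vpart (enum_val a) | a < #|kpart k n|].

(* This is meaningful only when v is a basis of V: then vpart_tuple is a basis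
   (vpart_basis) and vcoord lam is the coordinate along vpart lam. *)
Definition vcoord (lam : kpart k n) (x : sym_power V k) : F :=
  coord vpart_tuple (enum_rank lam) x.

(* Defined on the basis vpart; the formula on all products is sactE. *)
Definition sact (sigma : 'S_n) : 'End(sym_power V k) :=
  linfun (fun x => \sum_(lam : kpart k n)
    vcoord lam x *: boxv (fun j => sigma (tnth (val lam) j))).

Definition commutator_map (sigma : 'S_n) (f : 'End(sym_power V k)) :
  'End(sym_power V k) := (f \o sact sigma)%VF - (sact sigma \o f)%VF.

(* See mem_EndSn. *)
Definition EndSn : {vspace 'End(sym_power V k)} :=
  (\bigcap_(sigma : 'S_n) lker (linfun (commutator_map sigma)))%VS.

(* See EmapE. *)
Definition Emap (lam mu : kpart k n) : 'End(sym_power V k) :=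
  linfun (fun x => vcoord lam x *: vpart mu).

Definition Tmap (lam mu : kpart k n) : 'End(sym_power V k) :=
  \sum_(p : kpart k n * kpart k n |
         [exists rho : 'S_n, (lam == pact rho p.1) && (mu == pact rho p.2)])
    Emap p.1 p.2.

(* The value at an arbitrary member of C; the default 0 is never used when C is
   an equivalence class. *)
Definition Tclass (C : {set kpart k n * kpart k n}) : 'End(sym_power V k) :=
  if [pick p in C] is Some p then Tmap p.1 p.2 else 0.

Lemma boxv_perm (i i' : 'I_k -> 'I_n) :
  perm_eq [tuple i j | j < k] [tuple i' j | j < k] -> boxv i = boxv i'.
Proof.
move=> /tuple_permP[p /val_inj H].
rewrite /boxv -[RHS](box_symmetric _ p); congr box; apply/ffunP => j.
by rewrite !ffunE -[i j](tnth_mktuple i) H !tnth_mktuple.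
Qed.

Lemma tnth_kpart (l : k.-tuple 'I_n) : [tuple tnth l j | j < k] = l.
Proof. by apply: eq_from_tnth => j; rewrite tnth_mktuple. Qed.

Lemma boxv_sort (i : 'I_k -> 'I_n) : boxv i = vpart (sortp [tuple i j | j < k]).
Proof. by apply: boxv_perm; rewrite tnth_kpart /= perm_sym perm_sort. Qed.

Hypothesis v_basis : basis_of fullv v.

Lemma vpart_dual (lam : kpart k n) : exists f : 'Hom(sym_power V k, F^o),
  forall mu, f (vpart mu) = (mu == lam)%:R.
Proof.
pose I := {ffun 'I_k -> 'I_n}.
pose P (i : I) := sortp [tuple i j | j < k] == lam.
pose phi (w : {ffun 'I_k -> V}) : F^o :=
  \sum_(i : I | P i) \prod_(j < k) coord v (i j) (w j).
have phiL : multilinear phi.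
  move=> w j a x y; rewrite /phi scaler_sumr -big_split; apply: eq_bigr => i _.
  exact: (@prod_subst_slot F V k n (fun l => coord v l) i w j a x y).
have phiS : symmetric_map phi.
  move=> w tau; pose h (i : I) : I := [ffun j => i (tau j)].
  have h_inj : injective h.
    move=> i i' /ffunP H; apply/ffunP => j.
    by have := H (tau^-1 j)%g; rewrite !ffunE permKV.
  rewrite /phi (reindex_inj h_inj); apply: eq_big => [i|i _].
    rewrite /P; congr (_ == _); apply/sortpP/tuple_permP; exists tau.
    by congr tval; apply: eq_from_tnth => j; rewrite !tnth_mktuple ffunE.
  rewrite [RHS](reindex_inj (@perm_inj _ tau)); apply: eq_bigr => j _.
  by rewrite !ffunE.
have [f [fphi _]] := box_universal phiL phiS.
exists f => mu; rewrite fphi /phi.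
pose i0 : I := [ffun j => tnth (val mu) j].
have i0E : sortp [tuple i0 j | j < k] = mu.
  rewrite -[RHS]sortp_id; congr sortp.
  by apply: eq_from_tnth => j; rewrite tnth_mktuple ffunE.
have v_free := basis_free v_basis.
have prodE (i : I) : \prod_(j < k) coord v (i j) ([ffun j => tnth v (tnth (val mu) j)] j) =
    (i == i0)%:R :> F.
  have [->|/eqP/ffunP ne] := eqVneq i i0.
    by rewrite big1 // => j _; rewrite !ffunE (tnth_nth 0) coord_free ?eqxx.
  have [j nej] : exists j, i j <> i0 j.
    by apply: contrapT => /forallNP H; apply: ne => j; apply: contrapT (H j).
  rewrite (bigD1 j) //= ffunE (tnth_nth 0) coord_free //.
  by move: nej; rewrite ffunE; case: eqP => [->|_ _] //; rewrite mul0r.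
under eq_bigr do rewrite prodE.
rewrite big_mkcond (bigD1 i0) //= big1 => [|i /negbTE->]; last by rewrite if_same.
by rewrite eqxx addr0 /P i0E; case: eqP.
Qed.

Lemma vpart_nth (a : 'I_#|kpart k n|) : vpart_tuple`_a = vpart (enum_val a).
Proof. by rewrite -tnth_nth tnth_mktuple. Qed.

Lemma vpart_tupleE lam : vpart_tuple`_(enum_rank lam) = vpart lam.
Proof. by rewrite vpart_nth enum_rankK. Qed.

Lemma vpart_free : free vpart_tuple.
Proof.
apply/freeP => c c0 a; have [f fE] := vpart_dual (enum_val a).
have {}c0 : \sum_i c i *: vpart (enum_val i) = 0.
  by rewrite -[RHS]c0; apply: eq_bigr => b _; rewrite vpart_nth.
have := congr1 f c0; rewrite linear0 linear_sum (bigD1 a) //= big1 => [|b ba].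
  by rewrite addr0 linearZ /= fE eqxx /GRing.scale /= mulr1.
rewrite linearZ /= fE (inj_eq enum_val_inj) (negbTE ba).
exact: mulr0.
Qed.

Lemma vpart_basis : basis_of fullv vpart_tuple.
Proof.
rewrite /basis_of vpart_free andbT eqEsubv subvf /=; set Y := <<_>>%VS.
have Yv lam : vpart lam \in Y.
  by rewrite -vpart_tupleE memv_span // mem_nth // size_tuple.
pose p : 'End(sym_power V k) := (\1 - projv Y)%VF.
have pE x : p x = x - projv Y x by rewrite /p add_lfunE opp_lfunE id_lfunE.
have p0 w : p (box w) = 0.
  move: w; apply: (@multilinear_ext _ _ _ _ _ v (p \o @box F V k) (fun=> 0) v_basis).
  - by move=> w' i a x y; rewrite /= box_multilinear linearP.
  - by move=> w' i a x y; rewrite scaler0 addr0.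
  move=> i; rewrite /= -/(boxv i) boxv_sort pE projv_id ?subrr //.
apply/subvP => q _; suff : p q = 0.
  by rewrite pE => /subr0_eq ->; exact: memv_proj.
rewrite -[q]vreprK (tensor_decomp (vrepr q)) !linear_sum big1 // => i _.
by rewrite !linearZ /= p0 scaler0.
Qed.

Lemma vcoordE lam mu : vcoord lam (vpart mu) = (mu == lam)%:R.
Proof.
rewrite /vcoord -vpart_tupleE coord_free ?vpart_free //.
by rewrite (inj_eq enum_rank_inj).
Qed.

Lemma EmapE lam mu nu : Emap lam mu (vpart nu) = if nu == lam then vpart mu else 0.
Proof.
have L : linear (fun x => vcoord lam x *: vpart mu).
  by move=> a x y; rewrite /vcoord linearP scalerDl scalerA.
pose g : {linear sym_power V k -> sym_power V k} :=
  HB.pack (fun x => vcoord lam x *: vpart mu)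
    (GRing.isLinear.Build F _ _ _ (fun x => vcoord lam x *: vpart mu) L).
rewrite /Emap -[X in linfun X]/(g : _ -> _) lfunE /= vcoordE.
by case: eqP; rewrite ?scale1r ?scale0r.
Qed.

Lemma sactE (sigma : 'S_n) (i : 'I_k -> 'I_n) :
  sact sigma (boxv i) = boxv (fun j => sigma (i j)).
Proof.
pose s x := \sum_(lam : kpart k n)
    vcoord lam x *: boxv (fun j => sigma (tnth (val lam) j)).
have L : linear s.
  move=> a x y; rewrite /s scaler_sumr -big_split; apply: eq_bigr => lam _.
  by rewrite /vcoord linearP scalerDl scalerA.
pose g : {linear sym_power V k -> sym_power V k} :=
  HB.pack s (GRing.isLinear.Build F _ _ _ s L).
rewrite /sact -[X in linfun X]/(g : _ -> _) lfunE /= /s boxv_sort.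
set mu := sortp _; rewrite (bigD1 mu) //= big1 => [|lam /negbTE ne]; last first.
  by rewrite vcoordE eq_sym ne scale0r.
rewrite vcoordE eqxx scale1r addr0; apply: boxv_perm.
have E (h : 'I_k -> 'I_n) : [tuple sigma (h j) | j < k] = map_tuple sigma [tuple h j | j < k].
  by apply: eq_from_tnth => j; rewrite tnth_mktuple tnth_map tnth_mktuple.
by rewrite !E; apply: perm_map; rewrite tnth_kpart perm_sort.
Qed.

Lemma sact_vpart (sigma : 'S_n) lam : sact sigma (vpart lam) = vpart (pact sigma lam).
Proof.
rewrite /vpart sactE boxv_sort; congr (vpart (sortp _)).
by apply: eq_from_tnth => j; rewrite tnth_mktuple [RHS]tnth_map.
Qed.

Lemma mem_EndSn (f : 'End(sym_power V k)) :
  f \in EndSn <-> forall (sigma : 'S_n) x, f (sact sigma x) = sact sigma (f x).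
Proof.
have E sigma : linfun (commutator_map sigma) f = commutator_map sigma f.
  have L : linear (commutator_map sigma).
    move=> a g h; rewrite /commutator_map comp_lfunDl comp_lfunDr.
    by rewrite -comp_lfunZl -comp_lfunZr scalerBr opprD addrACA.
  pose c : {linear 'End(sym_power V k) -> 'End(sym_power V k)} :=
    HB.pack (commutator_map sigma)
      (GRing.isLinear.Build F _ _ _ (commutator_map sigma) L).
  by rewrite -[X in linfun X]/(c : _ -> _) lfunE.
rewrite -[f \in _]/(<[f]> <= _)%VS; split=> [/subv_bigcapP H sigma x|H].
  have := H sigma isT; rewrite -memvE memv_ker E subr_eq0 => /eqP/lfunP/(_ x).
  by rewrite !comp_lfunE.
apply/subv_bigcapP => sigma _; rewrite -memvE memv_ker E subr_eq0; apply/eqP/lfunP => x.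
by rewrite !comp_lfunE.
Qed.

End SymmetricAlgebra.

(* Main.v *)
(* Attach to f in End(V^k) its matrix coefficients at the pairs (lam, mu).  The
   group S_n permutes the basis v_lam, so f commutes with S_n exactly when these
   coefficients are constant on the orbits of pairs, which are the classes of ~.
   The coefficient function of T^C is the indicator function of C, and these
   indicators form a basis of the functions constant on the classes. *)
From HB Require Import structures.
Require Import Defs.
From mathcomp Require Import all_boot all_order all_algebra all_fingroup.
From mathcomp Require Import reals complex.

Set Implicit Arguments.
Unset Strict Implicit.
Unset Printing Implicit Defensive.

Import GRing.Theory.
Local Open Scope ring_scope.

(** If [w i] were in the span of the later vectors, it would lie in the kernel of [g i], which kills
    all of them; but [g i (w i) = 1]. *)
Lemma free_map_dual (F : fieldType) (T : vectType F) (I : eqType) (w : I -> T)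
    (g : I -> {linear T -> F^o}) (s : seq I) :
  uniq s -> {in s &, forall i j, g i (w j) = (i == j)%:R} -> free (map w s).
Proof.
elim: s => [|i s IHs] /=; first by rewrite nil_free.
case/andP=> is_ s_uniq gw; rewrite free_cons IHs ?andbT //; last first.
  by move=> j l js ls; rewrite gw ?inE ?js ?ls ?orbT.
apply/negP => wi; have : w i \in lker (linfun (g i)).
  apply: subvP wi; apply/span_subvP => _ /mapP[j js ->].
  rewrite memv_ker lfunE /= gw ?inE ?eqxx ?js ?orbT //.
  by have [ij|//] := eqVneq i j; rewrite -ij (negPf is_) in js.
by rewrite memv_ker lfunE /= gw ?mem_head // eqxx oner_eq0.
Qed.

Section SimClasses.
Variables k n : nat.
Implicit Types (p q : kpart k n * kpart k n) (C : {set kpart k n * kpart k n}).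

Let simE : {in [set: kpart k n * kpart k n] & &, equivalence_rel (@sim k n)}.
Proof. by move=> p q r _ _ _; apply: sim_equivalence. Qed.

Lemma sim_refl p : sim p p.
Proof. by case: (sim_equivalence p p p). Qed.

Lemma sim_left p q r : sim p q -> sim p r = sim q r.
Proof. by case: (sim_equivalence p q r) => _; apply. Qed.

Lemma sim_sym p q : sim p q = sim q p.
Proof. by apply/idP/idP => /sim_left <-; rewrite sim_refl. Qed.

Lemma sim_pact (s : 'S_n) p : sim (pact s p.1, pact s p.2) p.
Proof. by apply/existsP; exists s; rewrite !eqxx. Qed.

Lemma sim_classes_partition : partition (sim_classes k n) setT.
Proof. exact: equivalence_partitionP simE. Qed.

Lemma sim_class_mem C p q :
  C \in sim_classes k n -> p \in C -> (q \in C) = sim p q.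
Proof.
case/and3P: sim_classes_partition => _ trivP _ CP pC.
rewrite -(def_pblock trivP CP pC).
by rewrite (pblock_equivalence_partition simE) ?inE.
Qed.

Lemma sim_class_inhabited C : C \in sim_classes k n -> exists p, p \in C.
Proof.
case/and3P: sim_classes_partition => _ _ n0 CP.
by apply/set0Pn; apply: contraNneq n0 => <-.
Qed.

End SimClasses.

Section MatrixCoefficients.
Variables (F : fieldType) (V : vectType F) (n : nat) (v : n.-tuple V) (k : nat).
Implicit Types (p q : kpart k n * kpart k n) (C : {set kpart k n * kpart k n}).
Implicit Types f : 'End(sym_power V k).

(** The source index comes first: [p.1] is the column and [p.2] the row of the matrix entry. The
    codomain [F^o] makes this a linear form in [f]. *)
Definition vmxcoef p f : F^o := vcoord v p.2 (f (vpart v p.1)).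

Lemma vmxcoef_linear p : linear (vmxcoef p).
Proof. by move=> a f g; rewrite /vmxcoef add_lfunE scale_lfunE /vcoord linearP. Qed.

HB.instance Definition _ p :=
  GRing.isLinear.Build F _ _ _ (vmxcoef p) (vmxcoef_linear p).

(** The condition selecting the summands of [Tmap v p.1 p.2] unfolds to [sim p r], so only the class
    of [p] matters. *)
Lemma Tmap_sim p q : sim p q -> Tmap v p.1 p.2 = Tmap v q.1 q.2.
Proof. by move=> pq; apply: eq_bigl => r; apply: (sim_left r pq). Qed.

Lemma Tclass_sum C : C \in sim_classes k n ->
  Tclass v C = \sum_(p in C) Emap v p.1 p.2.
Proof.
move=> CP; rewrite /Tclass; case: pickP => [p pC|C0].
  by apply: eq_bigl => q; rewrite (sim_class_mem _ CP pC).
(* An empty [C] gives the default 0 on the left and an empty sum on the right. *)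
by rewrite big_pred0.
Qed.

Hypothesis v_basis : basis_of fullv v.

Lemma vcoord_sum (x : sym_power V k) : x = \sum_lam vcoord v lam x *: vpart v lam.
Proof.
rewrite [LHS](coord_basis (vpart_basis k v_basis) (memvf x)).
rewrite [RHS](reindex _ (onW_bij _ (@enum_val_bij (kpart k n)))) /=.
by apply: eq_bigr => a _; rewrite vpart_nth /vcoord enum_valK.
Qed.

Lemma lfun_vpartE f lam : f (vpart v lam) = \sum_mu (vmxcoef (lam, mu) f : F) *: vpart v mu.
Proof. exact: vcoord_sum. Qed.

Lemma vmxcoef_Emap p q : vmxcoef p (Emap v q.1 q.2) = (p == q)%:R.
Proof.
rewrite /vmxcoef EmapE // -pair_eqE /pair_eq; case: eqP => _ /=.
  by rewrite vcoordE // eq_sym.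
by rewrite /vcoord linear0.
Qed.

Lemma vmxcoef_inj f g : (forall p, vmxcoef p f = vmxcoef p g) -> f = g.
Proof.
move=> fg; apply/lfunP => x; rewrite [x]vcoord_sum !linear_sum.
apply: eq_bigr => lam _; rewrite !linearZ /= !lfun_vpartE; congr (_ *: _).
by apply: eq_bigr => mu _; rewrite fg.
Qed.

(** The action of [s] permutes the basis [vpart] through the injective map [pact s], so coordinates
    are only relabelled. *)
Lemma vcoord_sact (s : 'S_n) lam (x : sym_power V k) :
  vcoord v (pact s lam) (sact v k s x) = vcoord v lam x.
Proof.
have pactK (mu : kpart k n) : pact s^-1 (pact s mu) = mu by rewrite -pactM mulgV pact1.
rewrite {1}[x]vcoord_sum linear_sum {1}/vcoord linear_sum (bigD1 lam) //=.
rewrite big1 => [|mu mulam]; rewrite !linearZ /= -/(vcoord _ _ _).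
  by rewrite sact_vpart // vcoordE // eqxx addr0; apply: mulr1.
rewrite sact_vpart // vcoordE // (inj_eq (can_inj pactK)) (negPf mulam).
exact: mulr0.
Qed.

Lemma mem_EndSn_vmxcoef f :
  reflect (forall p q, sim p q -> vmxcoef p f = vmxcoef q f) (f \in EndSn v k).
Proof.
apply: (iffP idP) => [/mem_EndSn fS p q|fC].
  case/existsP=> s /andP[/eqP p1 /eqP p2].
  by rewrite /vmxcoef p1 p2 -sact_vpart // fS vcoord_sact.
apply/(mem_EndSn v) => s x.
suff: (f \o sact v k s = sact v k s \o f)%VF by move/lfunP/(_ x); rewrite !comp_lfunE.
apply: vmxcoef_inj => -[lam mu].
(* Writing [mu] as [pact s nu] lets [vcoord_sact] remove [s] on the right. What remains compares the
   coefficients of [f] at [(pact s lam, pact s nu)] and [(lam, nu)]. *)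
rewrite -[mu](pact1 mu) -(mulVg s) pactM; set nu := pact _ mu.
rewrite /vmxcoef !comp_lfunE /= sact_vpart // vcoord_sact.
exact: fC (sim_pact s (lam, nu)).
Qed.

Lemma vmxcoef_Tclass p C : C \in sim_classes k n ->
  vmxcoef p (Tclass v C) = (p \in C)%:R.
Proof.
move=> CP; rewrite Tclass_sum // linear_sum /=.
under eq_bigr do rewrite vmxcoef_Emap.
have [pC|pC] := boolP (p \in C).
  rewrite (bigD1 p) //= eqxx big1 ?addr0 // => q /andP[_].
  by rewrite eq_sym => /negPf ->.
by rewrite big1 // => q qC; case: eqP pC => // ->; rewrite qC.
Qed.

Lemma Tclass_EndSn C : C \in sim_classes k n -> Tclass v C \in EndSn v k.
Proof.
move=> CP; apply/mem_EndSn_vmxcoef => p q pq; rewrite !vmxcoef_Tclass //.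
congr (_%:R); congr nat_of_bool; apply/idP/idP => [pC|qC].
  by rewrite (sim_class_mem _ CP pC).
by rewrite (sim_class_mem _ CP qC) sim_sym.
Qed.

Lemma Tclass_free : free [seq Tclass v C | C <- enum (sim_classes k n)].
Proof.
(* The coefficient at one chosen member of each class: since classes are disjoint, these forms are
   dual to the [Tclass v C]. Classes are nonempty, so the default [\0] never occurs on them. *)
pose g C : {linear 'End(sym_power V k) -> F^o} :=
  if [pick p in C] is Some p then vmxcoef p else \0.
apply: (free_map_dual (g := g)) (enum_uniq _) _ => C D.
rewrite !mem_enum => CP DP; rewrite /g; case: pickP => [p pC|C0] /=.
  rewrite vmxcoef_Tclass //; congr (_%:R); congr nat_of_bool.
  case/and3P: (sim_classes_partition k n) => _ trivP _.
  have <- := def_pblock trivP CP pC.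
  by apply/idP/eqP => [/(def_pblock trivP DP)|<-]; rewrite ?(def_pblock trivP CP pC).
by have [p] := sim_class_inhabited CP; rewrite C0.
Qed.

Lemma EndSn_Tclass_span :
  (EndSn v k <= <<[seq Tclass v C | C <- enum (sim_classes k n)]>>)%VS.
Proof.
case/and3P: (sim_classes_partition k n) => /eqP coverP trivP _.
apply/subvP => f /mem_EndSn_vmxcoef fC.
(* The coefficients of [f] are constant on [C], so any member of [C] supplies the scalar. *)
pose c C := if [pick p in C] is Some p then vmxcoef p f : F else 0.
suff -> : f = \sum_(C in sim_classes k n) c C *: Tclass v C.
  by apply: rpred_sum => C CP; rewrite rpredZ ?memv_span ?map_f ?mem_enum.
apply: vmxcoef_inj => p; rewrite linear_sum /=.
have pP : pblock (sim_classes k n) p \in sim_classes k n.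
  by rewrite pblock_mem ?coverP ?inE.
have pp : p \in pblock (sim_classes k n) p by rewrite mem_pblock coverP inE.
(* Only the block containing [p] contributes to the coefficient at [p]. *)
rewrite (bigD1 _ pP) /= big1 => [|C /andP[CP neC]]; rewrite linearZ /= vmxcoef_Tclass //.
  rewrite pp addr0 /c; case: pickP => [q qP|/(_ p)]; last by rewrite pp.
  by rewrite [RHS]mulr1; apply: fC; rewrite -(sim_class_mem _ pP pp).
case: (boolP (p \in C)) neC => [pC|_ _]; last exact: mulr0.
by rewrite (def_pblock trivP CP pC) eqxx.
Qed.

End MatrixCoefficients.

Theorem theorem1 (R : realType) (n k : nat) (n_gt0 : (0 < n)%N) (k_gt0 : (0 < k)%N)
    (V : vectType R[i]) (v : n.-tuple V) (v_basis : basis_of fullv v) :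
  (forall lam mu lam' mu' : kpart k n,
      sim (lam, mu) (lam', mu') -> Tmap v lam mu = Tmap v lam' mu') /\
  basis_of (EndSn v k) [seq Tclass v C | C <- enum (sim_classes k n)].
Proof.
split=> [lam mu lam' mu'|]; first exact: Tmap_sim.
rewrite /basis_of Tclass_free // andbT eqEsubv EndSn_Tclass_span // andbT.
by apply/span_subvP => _ /mapP[C CP ->]; rewrite Tclass_EndSn // -mem_enum.
Qed.
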